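(* Let $m(x,y)=xy$. For every integer $L\ge 0$, $$\Pi_Lm(x,y)=m_{L+2}(x,y)\qquad\text{for all }(x,y)\in[-1,1]^2.$$
   Context: Let $h_\ell=2^{-\ell}$. For $\ell\ge0$ set $x_{\ell,i}=(i-2^\ell)h_\ell$, $y_{\ell,j}=(j-2^\ell)h_\ell$ for $i,j=0,1,\dots,2^{\ell+1}$. For $i,j\ne 2^{\ell+1}$ let $T^+_{\ell;i,j}=\{(x,y)\in[x_{\ell,i},x_{\ell,i}+h_\ell]\times[y_{\ell,j},y_{\ell,j}+h_\ell]: x+y\le x_{\ell,i}+y_{\ell,j}+h_\ell\}$, and for $i,j\neq0$ let $T^-_{\ell;i,j}=\{(x,y)\in[x_{\ell,i}-h_\ell,x_{\ell,i}]\times[y_{\ell,j}-h_\ell,y_{\ell,j}]: x+y\ge x_{\ell,i}+y_{\ell,j}-h_\ell\}$. These triangles form a uniform triangulation of $[-1,1]^2$. $\Pi_\ell m$ is the continuous piecewise linear interpolant of $m$ at the vertices of this triangulation; explicitly $\Pi_\ell m(x,y)=x\,y_{\ell,j}+y\,x_{\ell,i}-x_{\ell,i}y_{\ell,j}$ for $(x,y)\in T^+_{\ell;i,j}$ and for $(x,y)\in T^-_{\ell;i,j}$. Let $g(x)=2x$ on $[0,\tfrac12]$, $g(x)=2(1-x)$ on $(\tfrac12,1]$, $g(x)=0$ otherwise; $g_1=g$ and $g_\ell=g\circ g_{\ell-1}$ for $\ell\ge2$. For $L\ge1$ let $\hat s_L(x)=|x|-\sum_{\ell=1}^{L-1}h_\ell^2\,g_\ell(|x|)$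 and $$m_L(x,y)=2\left(\hat s_L\left(\tfrac{x+y}{2}\right)-\hat s_L\left(\tfrac{x}{2}\right)-\hat s_L\left(\tfrac{y}{2}\right)\right).$$ *)

(* Defs.v *)
From HB Require Import structures.
From mathcomp Require Import all_boot all_order all_algebra.
From mathcomp Require Import all_classical all_reals all_analysis.
Set Implicit Arguments.
Unset Strict Implicit.
Unset Printing Implicit Defensive.
Import Order.TTheory GRing.Theory Num.Theory.
Import numFieldNormedType.Exports.
Local Open Scope classical_set_scope.
Local Open Scope ring_scope.

Definition mesh (R : realType) (l : nat) : R := 2 ^- l.

(* The abscissas x_{l,i} and the ordinates y_{l,j} are given by the same
   formula; the index ranges over 0 <= i <= 2 ^ l.+1. *)
Definition node (R : realType) (l i : nat) : R :=
  (i%:R - 2 ^+ l) * mesh R l.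

Definition square (R : realType) : set (R * R) :=
  [set z | -1 <= z.1 <= 1 /\ -1 <= z.2 <= 1].

Arguments square R _ : clear implicits.

Definition Tplus (R : realType) (l i j : nat) : set (R * R) :=
  [set z | [/\ node R l i <= z.1 <= node R l i + mesh R l,
               node R l j <= z.2 <= node R l j + mesh R l
             & z.1 + z.2 <= node R l i + node R l j + mesh R l]].

Arguments Tplus R l i j _ : clear implicits.

Definition Tminus (R : realType) (l i j : nat) : set (R * R) :=
  [set z | [/\ node R l i - mesh R l <= z.1 <= node R l i,
               node R l j - mesh R l <= z.2 <= node R l j
             & node R l i + node R l j - mesh R l <= z.1 + z.2]].

Arguments Tminus R l i j _ : clear implicits.

Definition triangulation (R : realType) (l : nat) : set (set (R * R)) :=
  [set T | exists i j, [/\ (i < 2 ^ l.+1)%N, (j < 2 ^ l.+1)%N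
                         & T = Tplus R l i j]]
  `|`
  [set T | exists i j, [/\ (0 < i <= 2 ^ l.+1)%N, (0 < j <= 2 ^ l.+1)%N
                         & T = Tminus R l i j]].

Arguments triangulation R l _ : clear implicits.

Definition affine_on (R : realType) (T : set (R * R)) (p : R * R -> R) : Prop :=
  exists a b c : R, forall z, T z -> p z = a * z.1 + b * z.2 + c.

Definition is_pl_interpolant (R : realType) (l : nat) (f p : R * R -> R) : Prop :=
  [/\ {within square R, continuous p},
      (forall T, triangulation R l T -> affine_on T p)
    & (forall i j, (i <= 2 ^ l.+1)%N -> (j <= 2 ^ l.+1)%N ->
         p (node R l i, node R l j) = f (node R l i, node R l j))].

(* is_pl_interpolant determines p on the square only, so "the" interpolant is
   chosen classically; fun=> 0 is a junk value for when none exists. *)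
Definition pl_interpolant (R : realType) (l : nat) (f : R * R -> R) : R * R -> R :=
  xget (fun=> 0) [set p | is_pl_interpolant l f p].

Definition mul_fun2 (R : realType) (z : R * R) : R := z.1 * z.2.

Definition g (R : realType) (x : R) : R :=
  if 0 <= x <= 1 / 2 then 2 * x
  else if 1 / 2 < x <= 1 then 2 * (1 - x)
  else 0.

(* g_l is used for l >= 1 only; iter 1 (@g R) is convertible to g. *)
Definition g_ (R : realType) (l : nat) : R -> R := iter l (@g R).

Definition s_hat (R : realType) (L : nat) (x : R) : R :=
  `|x| - \sum_(1 <= l < L) mesh R l ^+ 2 * g_ l `|x|.

Definition m_ (R : realType) (L : nat) (x y : R) : R :=
  2 * (s_hat L ((x + y) / 2) - s_hat L (x / 2) - s_hat L (y / 2)).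

(* Main.v *)
Require Import Defs.
From mathcomp Require Import all_boot all_order all_algebra.
From mathcomp Require Import all_classical all_reals all_analysis.
From mathcomp Require Import ring lra zify.
Import Order.TTheory GRing.Theory Num.Theory.
Import numFieldNormedType.Exports.
Local Open Scope ring_scope.

(** The sawtooth sum is the dyadic interpolant of the square function.  Writing
    the sum of s_hat n.+1 as its first term plus a rescaled copy of the sum of
    s_hat n, for t in [0, 1] one gets
      s_hat n.+2 t = t - g t / 2 + s_hat n.+1 (g t) / 4,
    and t ^ 2 satisfies this same functional equation.  As g maps each dyadic
    cell of width 2 ^- n.+1 affinely onto one of width 2 ^- n, induction on n
    shows that on the cell [a, a + h], h = 2 ^- n, the function s_hat n.+1 is
    the chord (2 a + h) t - a (a + h) of t ^ 2 (lemma s_hat_chord).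

    By polarisation x y = 2 (((x + y) / 2) ^ 2 - (x / 2) ^ 2 - (y / 2) ^ 2), and
    m_ L.+2 replaces the three squares by their chords on cells of width
    2 ^- L.+1, that is, cells of width 2 ^- L for x + y, x and y.  The
    triangulation is cut out exactly by the lines where x, y or x + y is a
    multiple of 2 ^- L, so on each triangle all three chords are fixed affine
    functions, and their combination is x Y + y X - X Y, where (X, Y) is the
    right-angled vertex (m_upper_triangle, m_lower_triangle).  Being continuous,
    affine on triangles and exact at the nodes, m_ L.+2 is an interpolant
    (m_is_pl_interpolant).

    Any two interpolants agree on the square (pl_interpolant_unique): the
    triangles cover it, and an affine function on a triangle is determined by
    its values at the vertices.  Hence the classically chosen interpolant is
    m_ L.+2 there. *)

Set Implicit Arguments.
Unset Strict Implicit.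

(** * The mesh and its nodes *)

Lemma mesh_gt0 (R : realType) (l : nat) : 0 < mesh R l.
Proof. by rewrite /mesh invr_gt0 exprn_gt0. Qed.

Lemma meshS (R : realType) (l : nat) : mesh R l.+1 = mesh R l / 2.
Proof. by rewrite /mesh exprS invfM mulrC. Qed.

Lemma mesh_inv (R : realType) (l : nat) : 2 ^+ l * mesh R l = 1.
Proof. by rewrite /mesh mulfV// expf_neq0// pnatr_eq0. Qed.

Lemma nodeS (R : realType) (l i : nat) : node R l i.+1 = node R l i + mesh R l.
Proof. by rewrite /node -natr1; ring. Qed.

(** The nodes are integer multiples of the mesh; negative ones occur, so the
    index has to be an integer. *)
Lemma node_int (R : realType) (l i : nat) :
  node R l i = (i%:Z - 2 ^+ l)%:~R * mesh R l.
Proof. by rewrite /node rmorphB/= rmorphXn/=. Qed.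

Lemma node_bound (R : realType) (l i : nat) :
  (i <= 2 ^ l.+1)%N -> -1 <= node R l i <= 1.
Proof.
move=> il; have hl := mesh_inv R l; have h0 := mesh_gt0 R l.
have i0 : 0 <= i%:R * mesh R l by rewrite mulr_ge0// ltW.
have i2 : i%:R * mesh R l <= 2.
  rewrite (_ : 2 = 2 ^+ l.+1 * mesh R l); last by rewrite exprS -mulrA hl mulr1.
  by rewrite ler_pM2r// -natrX ler_nat.
by rewrite /node mulrBl hl; lra.
Qed.

(** The cells are closed so that the right end point t = n.+1 belongs to the
    last one. *)
Lemma nat_cell (R : realType) (n : nat) (t : R) :
  0 <= t <= n.+1%:R -> exists2 i, (i <= n)%N & i%:R <= t <= i.+1%:R.
Proof.
elim: n => [|n IH] t01; first by exists 0%N.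
have [tn|tn] := lerP t n.+1%:R; last by exists n.+1 => //; lra.
by have [|i ni it] := IH; [lra|exists i => //; exact: leqW].
Qed.

Lemma node_cell (R : realType) (l : nat) (x : R) : -1 <= x <= 1 ->
  exists2 i, (i < 2 ^ l.+1)%N & node R l i <= x <= node R l i + mesh R l.
Proof.
move=> x1; have hl := mesh_inv R l; have h0 := mesh_gt0 R l.
have p0 : 0 < (2 : R) ^+ l by rewrite exprn_gt0.
have [|i il it] := @nat_cell R (2 ^ l.+1).-1 ((x + 1) * 2 ^+ l).
  by rewrite prednK ?expn_gt0// natrX exprS; nra.
exists i; first by rewrite -[X in (_ < X)%N]prednK ?expn_gt0.
case/andP: it; rewrite -(ler_pM2r h0) -mulrA hl mulr1 => it1.
rewrite -(ler_pM2r h0) -mulrA hl mulr1 => it2.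
by rewrite -nodeS /node !mulrBl hl; lra.
Qed.

(** * The sawtooth sum as interpolant of the square function *)

Lemma g_left (R : realType) (x : R) : 0 <= x <= 1 / 2 -> g x = 2 * x.
Proof. by rewrite /g => ->. Qed.

Lemma g_right (R : realType) (x : R) : 1 / 2 <= x <= 1 -> g x = 2 * (1 - x).
Proof.
move=> /andP[x1 x2]; rewrite /g; case: ifPn => [/andP[_ x3]|x3]; first lra.
by rewrite ifT// x2 andbT; move: x3; rewrite negb_and -!ltNge => /orP[] ?; lra.
Qed.

(** Self-similarity of the sum: g_ l.+1 t = g_ l (g t), and one step down in
    level multiplies the squared mesh by 1 / 4. *)
Lemma s_hat_rec (R : realType) (n : nat) (t : R) : 0 <= t -> 0 <= g t ->
  s_hat n.+2 t = t - g t / 2 + s_hat n.+1 (g t) / 4.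
Proof.
move=> t0 gt0; rewrite /s_hat !ger0_norm//.
rewrite big_nat_recl//=.
rewrite (_ : \sum_(1 <= i < n.+1) mesh R i.+1 ^+ 2 * g_ i.+1 t =
  (\sum_(1 <= i < n.+1) mesh R i ^+ 2 * g_ i (g t)) / 4).
  by rewrite /mesh expr1; field.
rewrite mulr_suml; apply: eq_bigr => i _.
by rewrite /g_ iterSr meshS; field.
Qed.

(** In the induction step g is affine on each half of [0, 1]: it sends the cell
    at a to the cell at 2 a on the left half and, reversing orientation, to the
    cell at 2 - h - 2 a on the right half.  The index k is unrestricted: the
    cells that meet [0, 1] only at an end point satisfy the formula as well,
    which spares a discussion of where the cell lies. *)
Lemma s_hat_chord_pos (R : realType) (n : nat) (k : int) (a t : R) :
  a = k%:~R * mesh R n -> 0 <= t <= 1 -> a <= t <= a + mesh R n ->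
  s_hat n.+1 t = (2 * a + mesh R n) * t - a * (a + mesh R n).
Proof.
elim: n k a t => [|n IH] k a t aE t01 ta.
  have h1 : mesh R 0 = 1 by rewrite /mesh expr0 invr1.
  rewrite h1 mulr1 in aE ta *; rewrite {}aE in ta *.
  rewrite /s_hat big_geq// subr0 ger0_norm; last by lra.
  (* The cell [k, k + 1] meets [0, 1] only for k = -1, 0, 1, and t is 0 when
     k = -1 and 1 when k = 1. *)
  have k_ge : -1 <= k by rewrite -(ler_int R) rmorphN1; lra.
  have k_le : k <= 1 by rewrite -(ler_int R); lra.
  have : [|| k == -1, k == 0 | k == 1] by lia.
  by case/or3P => /eqP E; move: ta; rewrite E ?rmorphN1 => ta; nra.
rewrite meshS in aE ta *; have [t2|t2] := lerP t (1 / 2).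
  have gtE := @g_left R t ltac:(lra).
  have aE' : 2 * a = k%:~R * mesh R n by rewrite aE; field.
  by rewrite s_hat_rec ?gtE ?(IH _ _ _ aE'); [field|lra..].
have gtE := @g_right R t ltac:(lra).
have aE' : 2 - mesh R n - 2 * a = (2 ^+ n.+1 - 1 - k)%:~R * mesh R n.
  by rewrite aE !rmorphB rmorphXn/= exprS !mulrBl mul1r -mulrA mesh_inv; field.
by rewrite s_hat_rec ?gtE ?(IH _ _ _ aE'); [field|lra..].
Qed.

Lemma s_hatN (R : realType) (n : nat) (t : R) : s_hat n (- t) = s_hat n t.
Proof. by rewrite /s_hat normrN. Qed.

(** The negative half follows by evenness: - t lies in the cell at - a - h. *)
Lemma s_hat_chord (R : realType) (n : nat) (k : int) (a t : R) :
  a = k%:~R * mesh R n -> -1 <= t <= 1 -> a <= t <= a + mesh R n ->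
  s_hat n.+1 t = (2 * a + mesh R n) * t - a * (a + mesh R n).
Proof.
move=> aE t1 ta; have [t0|t0] := lerP 0 t.
  by apply: (s_hat_chord_pos aE) => //; lra.
have aE' : - a - mesh R n = (- k - 1)%:~R * mesh R n.
  by rewrite aE rmorphB rmorphN; ring.
by rewrite -s_hatN (s_hat_chord_pos aE'); [ring|lra..].
Qed.

(** The rescaling by 1 / 2 in the definition of m_ turns cells of width
    2 ^- L.+1 into cells of width 2 ^- L, the mesh of the triangulation. *)
Lemma s_hat_half_chord (R : realType) (L : nat) (k : int) (a t : R) :
  a = k%:~R * mesh R L -> - 2 <= t <= 2 -> a <= t <= a + mesh R L ->
  s_hat L.+2 (t / 2) = ((2 * a + mesh R L) * t - a * (a + mesh R L)) / 4.
Proof.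
move=> aE t2 ta.
have aE2 : a / 2 = k%:~R * mesh R L.+1 by rewrite aE meshS mulrA.
by rewrite (s_hat_chord aE2) ?meshS; [field|lra..].
Qed.

(** * The product on the triangles *)

(** The affine function obtained is the tangent plane of x y at (X, Y).  The
    three cell conditions say that x, y and x + y each stay in the cell to the
    right of X, Y and X + Y; they describe the triangle with right angle at the
    lower left vertex (X, Y). *)
Lemma m_upper_triangle (R : realType) (L : nat) (p q : int) (X Y x y : R) :
  X = p%:~R * mesh R L -> Y = q%:~R * mesh R L ->
  -1 <= x <= 1 -> -1 <= y <= 1 ->
  X <= x <= X + mesh R L -> Y <= y <= Y + mesh R L ->
  X + Y <= x + y <= X + Y + mesh R L ->
  m_ L.+2 x y = x * Y + y * X - X * Y.
Proof.
move=> XE YE x1 y1 xX yY xyXY.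
have XYE : X + Y = (p + q)%:~R * mesh R L by rewrite XE YE rmorphD/= mulrDl.
rewrite /m_ (s_hat_half_chord XYE) ?(s_hat_half_chord (t := x) XE)
  ?(s_hat_half_chord (t := y) YE).
  by field.
all: lra.
Qed.

(** Here x, y and x + y stay in the cells to the left of X, Y and X + Y.  The
    chord on [X - h, X] is the one on [X, X + h] with h replaced by - h, and h
    cancels in the combination, hence the same tangent plane. *)
Lemma m_lower_triangle (R : realType) (L : nat) (p q : int) (X Y x y : R) :
  X = p%:~R * mesh R L -> Y = q%:~R * mesh R L ->
  -1 <= x <= 1 -> -1 <= y <= 1 ->
  X - mesh R L <= x <= X -> Y - mesh R L <= y <= Y ->
  X + Y - mesh R L <= x + y <= X + Y ->
  m_ L.+2 x y = x * Y + y * X - X * Y.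
Proof.
move=> XE YE x1 y1 xX yY xyXY.
have pred_mesh a k : a = k%:~R * mesh R L ->
    a - mesh R L = (k - 1)%:~R * mesh R L.
  by move=> ->; rewrite rmorphB/= mulrBl mul1r.
have XYE : X + Y = (p + q)%:~R * mesh R L by rewrite XE YE rmorphD/= mulrDl.
rewrite /m_ (s_hat_half_chord (pred_mesh _ _ XYE))
  ?(s_hat_half_chord (t := x) (pred_mesh _ _ XE))
  ?(s_hat_half_chord (t := y) (pred_mesh _ _ YE)).
  by field.
all: lra.
Qed.

Lemma m_Tplus (R : realType) (L i j : nat) (z : R * R) :
  (i < 2 ^ L.+1)%N -> (j < 2 ^ L.+1)%N -> Tplus R L i j z ->
  m_ L.+2 z.1 z.2
    = z.1 * node R L j + z.2 * node R L i - node R L i * node R L j.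
Proof.
move=> iL jL [zi zj zij].
have := node_bound R iL; have := node_bound R jL; rewrite !nodeS => bi bj.
have bi' := node_bound R (ltnW iL); have bj' := node_bound R (ltnW jL).
by apply: (m_upper_triangle (node_int R L i) (node_int R L j)); lra.
Qed.

Lemma m_Tminus (R : realType) (L i j : nat) (z : R * R) :
  (0 < i <= 2 ^ L.+1)%N -> (0 < j <= 2 ^ L.+1)%N -> Tminus R L i j z ->
  m_ L.+2 z.1 z.2
    = z.1 * node R L j + z.2 * node R L i - node R L i * node R L j.
Proof.
case: i => // i; case: j => // j /= iL jL [zi zj zij].
have bi' := node_bound R (ltnW iL); have bj' := node_bound R (ltnW jL).
have := node_bound R iL; have := node_bound R jL => bj bi.
apply: (m_lower_triangle (node_int R L i.+1) (node_int R L j.+1)); try lra.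
all: by rewrite !nodeS in zi zj zij bi bj *; lra.
Qed.

(** * Continuity *)

(** This form has no case distinction, so that continuity is immediate. *)
Lemma gE (R : realType) (x : R) : g x = Num.max 0 (1 - `|2 * x - 1|).
Proof.
rewrite /g maxEle; case: ifPn => [/andP[x0 x1]|].
  rewrite ler0_norm; last by lra.
  by rewrite ifT; lra.
rewrite negb_and -!ltNge => x1; case: ifPn => [/andP[x2 x3]|x2].
  rewrite ger0_norm; last by lra.
  by rewrite ifT; lra.
case: (lerP 0 (1 - `|2 * x - 1|)) => //; rewrite subr_ge0 ler_norml => /andP[a b].
move: x2; rewrite negb_and -leNgt -ltNge; case/orP => x2; last by lra.
by case/orP: x1 => ?; lra.
Qed.

Lemma g_continuous (R : realType) : continuous (@g R).
Proof.
have -> : @g R = (fun x => Num.max 0 (1 - `|2 * x - 1|)).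
  by apply/funext => x; exact: gE.
move=> x; apply: (@continuous_max _ R (fun=> 0) (fun x => 1 - `|2 * x - 1|)).
  exact: cvg_cst.
apply: cvgB; first exact: cvg_cst.
apply: cvg_norm; apply: cvgB; last exact: cvg_cst.
by apply: cvgM; [exact: cvg_cst|exact: cvg_id].
Qed.

Lemma g_iter_continuous (R : realType) (l : nat) : continuous (@g_ R l).
Proof.
elim: l => [|l IH] x; first exact: cvg_id.
apply: (@continuous_comp _ _ _ (@g_ R l) (@g R)); first exact: IH.
exact: g_continuous.
Qed.

Lemma s_hat_continuous (R : realType) (n : nat) : continuous (@s_hat R n).
Proof.
move=> x; apply: cvgB; first exact: norm_continuous.
apply: cvg_big => [|l _]; first exact: add_continuous.
apply: cvgM; first exact: cvg_cst.
apply: (@continuous_comp _ _ _ (fun t : R => `|t|) (@g_ R l)).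
  exact: norm_continuous.
exact: g_iter_continuous.
Qed.

Lemma m_continuous (R : realType) (n : nat) :
  continuous (fun z : R * R => m_ n z.1 z.2).
Proof.
have s_comp (f : R * R -> R) : continuous f ->
    continuous (fun z => s_hat n (f z / 2)).
  move=> cf z; apply: (@continuous_comp _ _ _ (fun z => f z / 2) (@s_hat R n)).
    by apply: cvgM; [exact: cf|exact: cvg_cst].
  exact: s_hat_continuous.
have c1 : continuous (fun z : R * R => z.1) by move=> z; exact: cvg_fst.
have c2 : continuous (fun z : R * R => z.2) by move=> z; exact: cvg_snd.
move=> z; apply: cvgM; first exact: cvg_cst.
apply: cvgB; last exact: (s_comp _ c2).
apply: cvgB; last exact: (s_comp _ c1).
apply: (s_comp (fun z => z.1 + z.2)) => w.
by apply: cvgD; [exact: c1|exact: c2].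
Qed.

(** * Existence and uniqueness of the interpolant *)

Lemma m_is_pl_interpolant (R : realType) (L : nat) :
  is_pl_interpolant L (@mul_fun2 R) (fun z => m_ L.+2 z.1 z.2).
Proof.
split.
- by apply: continuous_subspaceT => z; exact: m_continuous.
- move=> T [[i [j [iL jL ->]]]|[i [j [iL jL ->]]]];
  exists (node R L j), (node R L i), (- (node R L i * node R L j)) => z Tz.
    by rewrite (m_Tplus iL jL Tz); ring.
  by rewrite (m_Tminus iL jL Tz); ring.
(* The tangent plane at (X, Y) touches x y there.  In m_upper_triangle only the
   point (x, y), here (X, Y) itself, has to lie in the square, so this also
   covers the nodes on the right and top sides, which have no Tplus. *)
- move=> i j iL jL; rewrite /mul_fun2/=.
  have bi := node_bound R iL; have bj := node_bound R jL; have h0 := mesh_gt0 R L.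
  rewrite (m_upper_triangle (node_int R L i) (node_int R L j) bi bj); [by ring|lra..].
Qed.

(** The sign of e is free: e = h for the triangles Tplus, e = - h for Tminus. *)
Lemma affine_on_unique (R : realType) (T : set (R * R)) (p q : R * R -> R)
    (z : R * R) (X Y e : R) :
  e != 0 -> affine_on T p -> affine_on T q -> T z ->
  T (X, Y) -> T (X + e, Y) -> T (X, Y + e) ->
  p (X, Y) = q (X, Y) -> p (X + e, Y) = q (X + e, Y) ->
  p (X, Y + e) = q (X, Y + e) ->
  p z = q z.
Proof.
move=> e0 [a [b [c pE]]] [a' [b' [c' qE]]] Tz T0 T1 T2.
rewrite !pE// !qE//= => E0 E1 E2.
have Ea : a = a' by apply: (mulIf e0); lra.
have Eb : b = b' by apply: (mulIf e0); lra.
by rewrite Ea Eb in E0 *; lra.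
Qed.

(** The antidiagonal of a cell splits it into the Tplus triangle at its lower
    left corner and the Tminus triangle at its upper right corner, hence the
    indices i.+1 and j.+1. *)
Lemma square_covered (R : realType) (l : nat) (z : R * R) : square R z ->
  (exists i j, [/\ (i < 2 ^ l.+1)%N, (j < 2 ^ l.+1)%N & Tplus R l i j z]) \/
  (exists i j, [/\ (i < 2 ^ l.+1)%N, (j < 2 ^ l.+1)%N & Tminus R l i.+1 j.+1 z]).
Proof.
move=> [/(node_cell l)[i il zi] /(node_cell l)[j jl zj]].
have [zij|zij] := lerP (z.1 + z.2) (node R l i + node R l j + mesh R l).
  by left; exists i, j; split.
by right; exists i, j; split => //; split; rewrite !nodeS; lra.
Qed.

Lemma pl_interpolant_unique (R : realType) (l : nat) (f p q : R * R -> R) :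
  is_pl_interpolant l f p -> is_pl_interpolant l f q ->
  forall z, square R z -> p z = q z.
Proof.
move=> [_ pT pN] [_ qT qN] z.
have h0 := mesh_gt0 R l; have h_neq0 := lt0r_neq0 h0.
case/(square_covered l) => -[i [j [il jl Tz]]].
- have T : triangulation R l (Tplus R l i j) by left; exists i, j.
  apply: (affine_on_unique (X := node R l i) (Y := node R l j) h_neq0
    (pT _ T) (qT _ T) Tz); rewrite -?nodeS ?pN ?qN// ?(ltnW il) ?(ltnW jl)//;
  by split; rewrite /= ?nodeS; lra.
- have T : triangulation R l (Tminus R l i.+1 j.+1) by right; exists i.+1, j.+1.
  have Nh_neq0 : - mesh R l != 0 by rewrite oppr_eq0.
  have nodeB k : node R l k.+1 - mesh R l = node R l k by rewrite nodeS addrK.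
  apply: (affine_on_unique (X := node R l i.+1) (Y := node R l j.+1) Nh_neq0
    (pT _ T) (qT _ T) Tz); rewrite ?nodeB ?pN ?qN// ?(ltnW il) ?(ltnW jl)//;
  by split; rewrite /= ?nodeS; lra.
Qed.

Unset Implicit Arguments.
Set Strict Implicit.

Theorem theorem4p1 (R : realType) (L : nat) (x y : R)
    (hx : -1 <= x <= 1) (hy : -1 <= y <= 1) :
  pl_interpolant L (@mul_fun2 R) (x, y) = m_ L.+2 x y.
Proof.
have m_interp := m_is_pl_interpolant R L.
apply: (pl_interpolant_unique (f := @mul_fun2 R)
  (q := fun z => m_ L.+2 z.1 z.2) _ m_interp); last by split.
exact: (xgetPex (fun=> 0) (ex_intro _ _ m_interp)).
Qed.
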